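(* Let $d\ge2$, $r\ge1$, $\mathbb I_d=\{1,\dots,d\}$, $\mathbb I_r=\{1,\dots,r\}$, $T>0$ and $m\in\mathbb I_r$. Let $\boldsymbol A\in\mathbb R_+^{r\times d}$ be a fixed matrix with no zero rows. Let $\boldsymbol L=(\boldsymbol L(t))_{t\ge0}$ be an $\mathbb R_+^d$-valued Lévy process satisfying the Insurance Claim Assumption (stated in the context), with $\alpha_k,b_k,f_k,\mu_k$, $k\in\mathbb I_d$, as in that assumption. Let $\boldsymbol a^{(P)}\in(0,\infty)^r$ with $\sum_{\ell=1}^r a^{(P)}_\ell=1$, let $\boldsymbol p^{(P)}\in\mathbb R_+^r$, and for $u>0$ put $$\boldsymbol R_u^{(P)}(t)=u\boldsymbol a^{(P)}+t\boldsymbol p^{(P)}-\boldsymbol A\boldsymbol L(t),\qquad t\ge0.$$ Let $$\Lambda_m^{(r)}=\{\boldsymbol y\in\mathbb R^r:\#\{\ell\in\mathbb I_r:y_\ell<0\}\ge m\},\qquad \psi_u^{(P)}(\Lambda_m^{(r)},T)=\mathbb P\big(\boldsymbol R_u^{(P)}(t)\in\Lambda_m^{(r)}\text{ for some }t\in[0,T]\big),$$ and $$\boldsymbol A^{-1}(B_{\Lambda_m}^{(r)})=\{\boldsymbol x\in\mathbb R_+^d:\#\{\ell\in\mathbb I_r:(\boldsymbol A\boldsymbol x)_\ell>a_\ell^{(P)}\}\ge m\}.$$ Set $i:=i_m(\boldsymbol A)$, where $$i_m(\boldsymbol A)=\min\{|S|:S\subset\mathbb I_d,\ |\Gamma_{\boldsymbol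 A}(S)|\ge m\},\qquad \Gamma_{\boldsymbol A}(S)=\{\ell\in\mathbb I_r:A_{\ell j}>0\text{ for some }j\in S\}.$$ If $\boldsymbol A^{-1}(B_{\Lambda_m}^{(r)})$ is a $\mu_i$-continuity set and $0<\mu_i\big(\boldsymbol A^{-1}(B_{\Lambda_m}^{(r)})\big)<\infty$, then $$\lim_{u\to\infty}b_i^{\leftarrow}(u)\,\psi_u^{(P)}(\Lambda_m^{(r)},T)=f_i(T)\,\mu_i\big(\boldsymbol A^{-1}(B_{\Lambda_m}^{(r)})\big).$$
   Context: Notation. $\mathbb R_+=[0,\infty)$. For $\boldsymbol z\in\mathbb R^d$, $z_{(1)}\ge\cdots\ge z_{(d)}$ are the decreasing order statistics of its coordinates. For a nondecreasing $g:\mathbb R_+\to\mathbb R_+$, the generalized inverse is $g^{\leftarrow}(u)=\inf\{t>0:g(t)\ge u\}$. A Lévy process has $\boldsymbol L(0)=\boldsymbol 0$ almost surely, stationary and independent increments, and càdlàg paths. An $\mathbb R_+^d$-valued Lévy process is a subordinator: its paths are coordinatewise nondecreasing. Subcones. For $i\in\mathbb I_d$, $$\mathbb{CA}_d^{(i-1)}=\{\boldsymbol z\in\mathbb R_+^d:z_{(i)}=0\},\qquad \mathbb E_d^{(i)}=\{\boldsymbol z\in\mathbb R_+^d:z_{(i)}>0\}=\mathbb R_+^d\setminus\mathbb{CA}_d^{(i-1)}.$$ $\mathcal B(\mathbb E_d^{(i)})$ is the Borel $\sigma$-algebra of $\mathbb E_d^{(i)}$. $\mathbb M(\mathbb E_d^{(i)})$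 is the space of Borel measures on $\mathbb E_d^{(i)}$ that are finite on sets bounded away from $\mathbb{CA}_d^{(i-1)}$ (i.e. sets at positive distance from $\mathbb{CA}_d^{(i-1)}$). A set $B$ is a $\mu$-continuity set if $\mu(\partial B)=0$. Regular variation. A measurable $f:\mathbb R_+\to\mathbb R_+$ is in $\mathcal{RV}_\beta$, $\beta\in\mathbb R$, if $f(ux)/f(u)\to x^\beta$ as $u\to\infty$ for all $x>0$. A random vector $\boldsymbol Z\in\mathbb R_+^d$ is in $\mathcal{MRV}(\alpha_i,b_i,\mu_i,\mathbb E_d^{(i)})$ if $\alpha_i>0$, $b_i\in\mathcal{RV}_{1/\alpha_i}$, $\mu_i\in\mathbb M(\mathbb E_d^{(i)})$ is non-zero, and $$\lim_{u\to\infty}u\,\mathbb P\big(\boldsymbol Z\in b_i(u)B\big)=\mu_i(B)$$ for every $\mu_i$-continuity set $B\in\mathcal B(\mathbb E_d^{(i)})$ bounded away from $\mathbb{CA}_d^{(i-1)}$. Insurance Claim Assumption. $\boldsymbol L$ is an $\mathbb R_+^d$-valued Lévy process, and for each $k\in\mathbb I_d$ there exist a constant $\alpha_k>0$, a scaling function $b_k\in\mathcal{RV}_{1/\alpha_k}$, a non-zero measure $\mu_k$ on $\mathbb E_d^{(k)}$, and a positive measurable function $f_k:(0,\infty)\to(0,\infty)$ with $f_k(1)=1$ such that $\boldsymbol L(T)\in\mathcal{MRV}(\alpha_k,b_k,f_k(T)\mu_k,\mathbb E_d^{(k)})$ for every $T>0$. The set $B_{\Lambda_m}^{(r)}=\{\boldsymbol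 y\in\mathbb R_+^r:\#\{\ell\in\mathbb I_r:y_\ell>a_\ell^{(P)}\}\ge m\}$ is the normalized portfolio-level claim region, and $\boldsymbol A^{-1}(B_{\Lambda_m}^{(r)})$ is its pre-image in $\mathbb R_+^d$ under $\boldsymbol x\mapsto\boldsymbol A\boldsymbol x$. *)

(* Defs.v *)
From HB Require Import structures.
From mathcomp Require Import all_boot all_order all_algebra.
From mathcomp Require Import all_classical all_reals all_analysis.
Import Order.TTheory GRing.Theory Num.Theory.
Import numFieldNormedType.Exports.

Set Implicit Arguments.
Unset Strict Implicit.
Unset Printing Implicit Defensive.

Local Open Scope classical_set_scope.
Local Open Scope ring_scope.

(* 'cV[R]_d with its Borel sigma-algebra. *)
Definition borelcV (R : realType) (d : nat) :=
  g_sigma_algebraType (@open 'cV[R]_d).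

Section Subcones.
Context {R : realType} {d : nat}.
Implicit Types (z : 'cV[R]_d) (B C E : set 'cV[R]_d).

Definition orthant : set 'cV[R]_d := [set z | forall j, 0 <= z j 0].

(* The indices k and i below are 1-based: 1 <= k <= d. *)
Definition order_stat z (k : nat) : R :=
  nth 0 (sort (fun x y => y <= x) [seq z j 0 | j <- enum 'I_d]) k.-1.

(* CAcone i is the cone written CA_d^(i-1). *)
Definition CAcone (i : nat) : set 'cV[R]_d :=
  orthant `&` [set z | order_stat z i = 0].

Definition Econe (i : nat) : set 'cV[R]_d :=
  orthant `&` [set z | 0 < order_stat z i].

Definition bounded_away B C : Prop :=
  exists2 e : R, 0 < e & forall x y, B x -> C y -> e <= `|x - y|.

(* Boundary of B in the subspace topology of E; the boundary in 'cV[R]_d would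
   contain the faces of the orthant, which may carry mass. *)
Definition boundary_in E B : set 'cV[R]_d :=
  E `&` (closure B `&` closure (E `\` B)).

(* A Borel measure on Econe i is encoded as its extension by zero. *)
Record Mclass (i : nat) (mu : {measure set (borelcV R d) -> \bar R}) : Prop := {
  Mclass_supp : mu (~` Econe i) = 0%E ;
  Mclass_fin : forall B, measurable (B : set (borelcV R d)) ->
    B `<=` Econe i -> bounded_away B (CAcone i) -> (mu B < +oo)%E }.

Definition continuity_set (i : nat)
    (mu : {measure set (borelcV R d) -> \bar R}) B : Prop :=
  mu (boundary_in (Econe i) B) = 0%E.

End Subcones.

Section RegularVariation.
Context {R : realType}.

Record RV (beta : R) (f : R -> R) : Prop := {
  RV_meas : measurable_fun (`[0, +oo[ : set R) f ;
  RV_ge0 : forall u : R, 0 <= u -> 0 <= f u ;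
  RV_cvg : forall x : R, 0 < x -> f (u * x) / f u @[u --> +oo] --> x `^ beta }.

Definition ginv (g : R -> R) (u : R) : R := inf [set t | 0 < t /\ u <= g t].

Record MRV {disp : measure_display} {Omega : measurableType disp}
    (P : probability Omega R) (d : nat) (Z : Omega -> 'cV[R]_d)
    (alpha : R) (b : R -> R) (mu : {measure set (borelcV R d) -> \bar R})
    (i : nat) : Prop := {
  MRV_meas : measurable_fun setT (Z : Omega -> borelcV R d) ;
  MRV_ge0 : forall w, orthant (Z w) ;
  MRV_alpha : 0 < alpha ;
  MRV_b : RV alpha^-1 b ;
  MRV_mu : Mclass i mu ;
  MRV_mu_neq0 : mu setT <> 0%E ;
  MRV_cvg : forall B : set 'cV[R]_d, measurable (B : set (borelcV R d)) ->
    B `<=` Econe i -> bounded_away B (CAcone i) -> continuity_set i mu B ->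
    (u%:E * P [set w | ([set b u *: x | x in B]) (Z w)])%E @[u --> +oo]
      --> mu B }.

End RegularVariation.

Section Process.
Context {R : realType} {disp : measure_display} {Omega : measurableType disp}.
Variable P : probability Omega R.

(* Only times t >= 0 matter; L t is arbitrary for t < 0. *)
Record Levy (d : nat) (L : R -> Omega -> 'cV[R]_d) : Prop := {
  Levy_meas : forall t : R, 0 <= t ->
    measurable_fun setT (L t : Omega -> borelcV R d) ;
  Levy_0 : {ae P, forall w, L 0 w = 0} ;
  Levy_stationary : forall s t : R, 0 <= s -> s <= t ->
    forall B, measurable (B : set (borelcV R d)) ->
      P [set w | B (L t w - L s w)] = P [set w | B (L (t - s) w)] ;
  Levy_indep : forall (n : nat) (t : nat -> R), 0 <= t 0%N ->
    (forall k, (k < n)%N -> t k <= t k.+1) ->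
    forall B : nat -> set 'cV[R]_d,
      (forall k, measurable (B k : set (borelcV R d))) ->
      P [set w | forall k, (k < n)%N -> B k (L (t k.+1) w - L (t k) w)] =
      (\prod_(k < n) P [set w | B k (L (t k.+1) w - L (t k) w)%R])%E ;
  Levy_right_continuous : forall w (t : R), 0 <= t ->
    L s w @[s --> t^'+] --> L t w ;
  Levy_left_limit : forall w (t : R), 0 < t -> cvg (L s w @[s --> t^'-]) }.

(* Functions and measures are indexed by k : nat, and only 1 <= k <= d
   matters. The codomain {posnum R} makes each f k a positive function on
   (0, +oo); its values at t <= 0 are irrelevant. *)
Record insurance_claim_assumption (d : nat) (L : R -> Omega -> 'cV[R]_d)
    (alpha : nat -> R) (b : nat -> R -> R) (f : nat -> R -> {posnum R})
    (mu : nat -> {measure set (borelcV R d) -> \bar R}) : Prop := {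
  ICA_Levy : Levy L ;
  ICA_ge0 : forall (t : R) w, 0 <= t -> orthant (L t w) ;
  ICA_alpha : forall k, (1 <= k <= d)%N -> 0 < alpha k ;
  ICA_b : forall k, (1 <= k <= d)%N -> RV (alpha k)^-1 (b k) ;
  ICA_mu_supp : forall k, (1 <= k <= d)%N -> mu k (~` Econe k) = 0%E ;
  ICA_mu_neq0 : forall k, (1 <= k <= d)%N -> mu k setT <> 0%E ;
  ICA_f_meas : forall k, (1 <= k <= d)%N ->
    measurable_fun (`]0, +oo[ : set R) (fun t => (f k t)%:num) ;
  ICA_f1 : forall k, (1 <= k <= d)%N -> (f k 1)%:num = 1 ;
  ICA_MRV : forall k, (1 <= k <= d)%N -> forall T : R, 0 < T ->
    MRV P (L T) (alpha k) (b k) (mscale (f k T)%:num%:nng (mu k)) k }.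

End Process.

Section Portfolio.
Context {R : realType} {d r : nat}.
Implicit Types (A : 'M[R]_(r, d)) (a p : 'cV[R]_r).

Definition Gamma A (S : {set 'I_d}) : {set 'I_r} :=
  finset (fun l => [exists j in S, 0 < A l j]).

(* The default value d is harmless: every |S| is at most d, and S = 'I_d is
   admissible when A is nonnegative with no zero row and m <= r. *)
Definition i_min (m : nat) A : nat :=
  \big[minn/d]_(S : {set 'I_d} | (m <= #|Gamma A S|)%N) #|S|.

Definition Lambda (m : nat) : set 'cV[R]_r :=
  [set y | (m <= #|[pred l : 'I_r | (y l 0 < 0)%R]|)%N].

Definition claim_region a (m : nat) : set 'cV[R]_r :=
  [set y | orthant y /\ (m <= #|[pred l : 'I_r | (a l 0 < y l 0)%R]|)%N].

Definition claim_preimage A a (m : nat) : set 'cV[R]_d :=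
  orthant `&` (fun x => A *m x) @^-1` claim_region a m.

Definition reserve {Omega : Type} A a p (L : R -> Omega -> 'cV[R]_d)
    (u t : R) (w : Omega) : 'cV[R]_r :=
  u *: a + t *: p - A *m L t w.

Definition ruin_prob {disp : measure_display} {Omega : measurableType disp}
    (P : probability Omega R) A a p (L : R -> Omega -> 'cV[R]_d)
    (m : nat) (T u : R) : \bar R :=
  P [set w | exists t : R, 0 <= t <= T /\ Lambda m (reserve A a p L u t w)].

End Portfolio.

(* Main.v *)
Require Import Defs.
From mathcomp Require Import all_boot all_order all_algebra.
From mathcomp Require Import all_classical all_reals all_analysis.
From mathcomp Require Import lra ring.
Import Order.TTheory GRing.Theory Num.Theory.
Import numFieldNormedType.Exports.
Set Implicit Arguments.
Unset Strict Implicit.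

Local Open Scope classical_set_scope.
Local Open Scope ring_scope.

(** Claims only accumulate, so up to a vanishing relative error ruin before [T]
    is a question about [L T] alone. Let [q s] be the probability that at least
    [m] coordinates of [A *m L T] exceed those of [s *: a]. If ruin occurs at
    some [t <= T], the premiums are nonnegative and almost surely
    [L t <= L T], hence [ruin u] has probability at most [q u]
    ([ruin_le_claim]). Conversely, evaluating the reserve at time [T] shows that
    it has probability at least [q (u * g)] for every [g > 1] and large [u],
    because the premium income [T *: p] is negligible with respect to [u *: a]
    ([claim_le_ruin]). Right-continuity of the paths and openness of the ruin
    region reduce the uncountable union over [t] to rational times and [T]
    ([ruinE]); this yields both the measurability of the ruin event and the
    null set outside which [L t <= L T] at all relevant times.

    The definition of [i_min] puts the claim region at positive distance from
    the cone [CAcone i] ([claim_preimage_away]): a point of the cone has fewer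
    than [i] positive coordinates, these feed fewer than [m] rows of [A], and
    the remaining rows of a nearby point stay below the barrier [a]. Regular
    variation of [L T] therefore gives that [v * q (b v)] tends to
    [c = f T * mu C].

    It remains to replace [b v] by [u] ([cvg_ginv_tail]). With [v = ginv b u]
    and [k < 1 < l], monotonicity gives [b (v * k) < u <= b (v * l)], and regular
    variation of [b] gives [g > 1] with [u * g <= b (v * l ^ 2)] for large [u].
    As [q] is nonincreasing, [v] times the ruin probability lies asymptotically
    between [c / l ^ 2] and [c / k], and [k], [l] are arbitrarily close to 1. *)

(** * Regularly varying scaling functions and their generalized inverses *)

Section Inversion.
Context {R : realType}.
Implicit Types (b q psi : R -> R) (beta c g l u v : R).

(** The ratio [b (u * x) / b u] tends to [x `^ beta > 1]; any [g] strictly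
    between 1 and that limit works. *)
Lemma RV_growth beta b x : 0 < beta -> RV beta b -> 1 < x ->
  exists2 g, 1 < g & \forall u \near +oo, 0 < b u /\ g * b u <= b (u * x).
Proof.
move=> beta0 [_ b0 bx] x1.
have xb1 : 1 < x `^ beta.
  have <- : 1 `^ beta = 1 by rewrite powR1.
  by rewrite gt0_ltr_powR// ?nnegrE; lra.
exists ((1 + x `^ beta) / 2); first by lra.
have := cvgr_gt _ (bx x (lt_trans ltr01 x1)).
move=> /(_ _ ((1 + x `^ beta) / 2)) ratio_gt.
near=> u.
have u0 : 0 <= u by near: u; exact: nbhs_pinfty_ge.
have rat : (1 + x `^ beta) / 2 < b (u * x) / b u.
  by near: u; apply: ratio_gt; lra.
have bu : 0 < b u.
  rewrite lt_neqAle b0// andbT eq_sym; apply: contraTneq rat => ->.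
  (* If b u = 0, the ratio is 0 by the convention on inverses. *)
  by rewrite invr0 mulr0 -leNgt; lra.
by split=> //; rewrite -ler_pdivlMr// ltW.
Unshelve. all: by end_near. Qed.

(** Otherwise [b t] comes within the factor [g > 1] of its finite supremum, and
    [b (2 * t) >= g * b t] exceeds it. *)
Lemma RV_unbounded beta b : 0 < beta -> RV beta b ->
  (forall x y : R, 0 <= x -> x <= y -> b x <= b y) ->
  forall M, exists2 t : R, 0 < t & M <= b t.
Proof.
move=> beta0 bRV bmono M; apply: contrapT => nex.
have blt t : 0 < t -> b t < M.
  by move=> t0; rewrite ltNge; apply/negP => Mt; apply: nex; exists t.
have [g g1 [N [_ HN]]] := RV_growth beta0 bRV (ltr1n R 2).
pose E := b @` [set t | 0 < t].
have E1 : E (b 1) by exists 1 => /=; rewrite ?ltr01.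
have supE : has_sup E.
  by split; [exists (b 1)|exists M => _ [t t0 <-]; exact/ltW/blt].
pose N1 := Num.max (N + 1) 1.
have N11 : 1 <= N1 by rewrite le_max lexx orbT.
have NN1 : N < N1 by rewrite lt_max ltrDl ltr01.
have S0 : 0 < sup E.
  apply: (@lt_le_trans _ _ (b N1)); first by have [] := HN _ NN1.
  by apply: ub_le_sup; [exact: supE.2|exists N1 => //=; lra].
have eps0 : 0 < sup E - sup E / g by rewrite subr_gt0 ltr_pdivrMr; nra.
have [_ [t /= t0 <-] ht] := sup_adherent eps0 supE.
have {}ht : sup E < g * b t by rewrite mulrC -ltr_pdivrMr; lra.
pose s := Num.max t N1.
have ts : t <= s by rewrite le_max lexx.
have Ns : N1 <= s by rewrite le_max lexx orbT.
have [_ h2] := HN s (lt_le_trans NN1 Ns).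
have : b (s * 2) <= sup E.
  by apply: ub_le_sup; [exact: supE.2|exists (s * 2) => //=; lra].
have := bmono _ _ (ltW t0) ts; nra.
Qed.

Lemma lt_ginv b u t : 0 < t -> t < ginv b u -> b t < u.
Proof.
move=> t0; rewrite !ltNge; apply: contra => ut.
by apply: ge_inf => //=; exists 0 => s [/ltW].
Qed.

Lemma gt_ginv b u t (bmono : forall x y : R, 0 <= x -> x <= y -> b x <= b y) :
  (exists2 s : R, 0 < s & u <= b s) -> ginv b u < t -> u <= b t.
Proof.
move=> [s s0 us] vt.
have infS : has_inf [set t | 0 < t /\ u <= b t].
  by split; [exists s|exists 0 => z [/ltW]].
have [z [z0 uz]] := inf_adherent (eps := t - ginv b u) ltac:(lra) infS.
rewrite -/(ginv b u) => zt; apply: (le_trans uz); apply: bmono; lra.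
Qed.

Lemma ginv_pinfty b (bmono : forall x y : R, 0 <= x -> x <= y -> b x <= b y) :
  (forall M, exists2 t : R, 0 < t & M <= b t) -> ginv b u @[u --> +oo] --> +oo.
Proof.
move=> bunb; apply/cvgryPge => M; near=> u.
rewrite leNgt; apply/negP => vM.
have : u <= b (Num.max M 0).
  apply: (gt_ginv bmono (bunb u)).
  by rewrite lt_max vM.
by apply/negP; rewrite -ltNge; near: u; apply: nbhs_pinfty_gt; rewrite num_real.
Unshelve. all: by end_near. Qed.

(** Monotonicity of [q] absorbs the jumps of [b]: with [v = ginv b u], the values
    of [q] near level [u] are squeezed between those at [b (v * k)] and
    [b (v * l ^ 2)] for [k < 1 < l], where the scaled tail is known. The lower
    bound on [psi] is asked at the levels [u * g], since [psi u] may stay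
    strictly below [q u]. *)
Lemma cvg_ginv_tail beta b q psi c :
  0 < beta -> RV beta b ->
  (forall x y : R, 0 <= x -> x <= y -> b x <= b y) ->
  (forall x y : R, x <= y -> q y <= q x) -> (forall u, 0 <= q u) -> 0 <= c ->
  u * q (b u) @[u --> +oo] --> c ->
  (\forall u \near +oo, psi u <= q u) ->
  (forall g, 1 < g -> \forall u \near +oo, q (u * g) <= psi u) ->
  ginv b u * psi u @[u --> +oo] --> c.
Proof.
move=> beta0 bRV bmono qanti q0 c0 qc psiq qpsi.
have bunb := RV_unbounded beta0 bRV bmono.
have ginfty := ginv_pinfty bmono bunb.
have scaled k (k0 : 0 < k) : ginv b u * k @[u --> +oo] --> +oo.
  apply/cvgryPge => M; have /cvgryPge/(_ (M / k)) := ginfty.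
  by apply: filterS => u; rewrite ler_pdivrMr.
have tail k (k0 : 0 < k) :
    ginv b u * k * q (b (ginv b u * k)) @[u --> +oo] --> c.
  exact: (cvg_comp _ _ (scaled k k0) qc).
apply/cvgrPdist_lt => e e0.
(* upper bound: b (k v) < u for k < 1, and c / k < c + e *)
pose k := (c + e / 2) / (c + e).
have k0 : 0 < k by rewrite divr_gt0; lra.
have k1 : k < 1 by rewrite ltr_pdivrMr; lra.
have kce : k * (c + e) = c + e / 2 by rewrite divfK//; lra.
(* lower bound: u <= b (l v) for l > 1, and c / l ^ 2 > c - e *)
pose h := 1 + e / (c + 1).
have h1 : 1 < h by rewrite ltrDl divr_gt0; lra.
have hce : h * (c - e) < c.
  have z0 : 0 < e / (c + 1) by rewrite divr_gt0//; lra.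
  have : (e / (c + 1)) * (c + 1) = e by rewrite divfK//; lra.
  rewrite /h; move: (e / (c + 1)) z0 => z z0 zc; nra.
pose l := Num.sqrt h.
have l1 : 1 < l by rewrite -[1]sqrtr1 ltr_sqrt//; lra.
have ll : l * l = h by rewrite -expr2 sqr_sqrtr//; lra.
have [g g1 growth] := RV_growth beta0 bRV l1.
have growth' : \forall u \near +oo,
    0 < b (ginv b u * l) /\ g * b (ginv b u * l) <= b (ginv b u * l * l).
  exact: (scaled l (lt_trans ltr01 l1) _ growth).
near=> u.
have v0 : 0 < ginv b u.
  by near: u; move/cvgryPgt : ginfty; exact.
have bku : b (ginv b u * k) < u by apply: lt_ginv; nra.
have blu : u <= b (ginv b u * l) by apply: gt_ginv; [| |nra].
have [bl0 gbl] : 0 < b (ginv b u * l) /\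
    g * b (ginv b u * l) <= b (ginv b u * l * l) by near: u.
have gbu : u * g <= b (ginv b u * h) by rewrite -ll mulrA; nra.
have up : ginv b u * k * q (b (ginv b u * k)) < c + e / 2.
  by near: u; apply: (cvgr_lt _ (tail k k0)); lra.
have lo : h * (c - e) < ginv b u * h * q (b (ginv b u * h)).
  by near: u; apply: (cvgr_gt _ (tail h _)) => //; lra.
have p1 : psi u <= q u by near: u.
have p2 : q (u * g) <= psi u by near: u; exact: qpsi.
have q1 := qanti _ _ (ltW bku).
have q2 := qanti _ _ gbu.
rewrite ltr_distlC; apply/andP; split.
  rewrite -(ltr_pM2l (lt_trans ltr01 h1)); apply: (lt_le_trans lo).
  rewrite -mulrA mulrCA ler_pM2l; last by lra.
  by rewrite ler_pM2l//; lra.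
rewrite -(ltr_pM2l k0) kce; apply: le_lt_trans up.
by rewrite -mulrA mulrCA ler_pM2l// ler_pM2l//; lra.
Unshelve. all: by end_near. Qed.

End Inversion.

(** * The claim region and the cones *)

Section Cones.
Context {R : realType}.

Lemma card_Gamma_lt {d r : nat} (m : nat) (A : 'M[R]_(r, d)) (S : {set 'I_d}) :
  (#|S| < i_min m A)%N -> (#|Gamma A S| < m)%N.
Proof.
rewrite !ltnNge; apply: contra => mS.
exact: (bigmin_le_cond d (fun S : {set 'I_d} => #|S| : nat) mS).
Qed.

Lemma i_min_bounds {d r : nat} (m : nat) (A : 'M[R]_(r, d)) :
  (0 < m)%N -> (0 < d)%N -> (1 <= i_min m A <= d)%N.
Proof.
move=> m0 d0; apply/andP; split.
  rewrite /i_min; apply: (big_ind (fun n => 1 <= n)%N) => //.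
    by move=> x y x0 y0; rewrite leq_min x0.
  move=> S; apply: contraTT; rewrite -!ltnNge ltnS leqn0 cards_eq0 => /eqP ->.
  rewrite (_ : Gamma A _ = finset.set0) ?cards0//.
  by apply/setP => l; rewrite !inE; apply/existsP => -[j]; rewrite inE.
exact: (bigmin_le_id (index_enum {set 'I_d}) (d : nat)).
Qed.

(** In the decreasing arrangement every entry from position [i] on is at most
    the vanishing [i]-th one. *)
Lemma card_pos_CAcone {d : nat} (i : nat) (y : 'cV[R]_d) :
  (1 <= i <= d)%N -> CAcone i y ->
  (#|finset (fun j => (0 < y j 0)%R)| < i)%N.
Proof.
move=> /andP[i1 id] [y0].
rewrite /order_stat /=; set s := sort _ _ => si0.
have ges : sorted (fun x z : R => z <= x) s.
  by apply: sort_sorted => x z; exact: le_total.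
have sizes : size s = d by rewrite size_sort size_map size_enum_ord.
have -> : #|finset (fun j => (0 < y j 0)%R)| = count (fun x : R => 0 < x) s.
  rewrite (permP (permEl (perm_sort _ _))) count_map cardE size_filter /=.
  rewrite enumT; apply: eq_count => j; by rewrite !inE.
rewrite -(cat_take_drop i.-1 s) count_cat.
rewrite [X in (_ + X)%N](_ : _ = 0%N) ?addn0.
  apply: leq_ltn_trans (count_size _ _) _.
  by rewrite size_takel ?prednK// sizes (leq_trans (leq_pred _)).
apply/eqP; rewrite -leqn0 leqNgt -has_count; apply/hasPn => x.
move=> /(nthP 0)[n]; rewrite size_drop nth_drop -leNgt => ns <-.
rewrite -[leRHS]si0.
have tr : transitive (fun x z : R => z <= x).
  by move=> a b c ab bc; exact: le_trans bc ab.
apply: (sorted_leq_nth tr _ 0 ges) => //; last exact: leq_addr.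
- by rewrite inE sizes prednK.
- by rewrite inE -ltn_subRL.
Qed.

Lemma order_stat_ge0 {d : nat} (i : nat) (x : 'cV[R]_d) :
  orthant x -> 0 <= order_stat x i.
Proof.
move=> x0; rewrite /order_stat; set s := sort _ _.
case: (ltnP i.-1 (size s)) => [ltis|?]; last by rewrite nth_default.
have := mem_nth 0 ltis; rewrite mem_sort => /mapP[j _ ->]; exact: x0.
Qed.

Lemma ler_coord_norm {d : nat} (x : 'cV[R]_d) j : `|x j 0| <= `|x|.
Proof.
rewrite /Num.Def.normr/= mx_normrE.
exact: (le_bigmax _ (fun ij : 'I_d * 'I_1 => `|x ij.1 ij.2|) (j, 0)).
Qed.

(** Let [x] be in the claim region, [y] in the cone, [S] the support of [y]. As
    [|S| < i_min m A], fewer than [m] rows of [A] meet [S]. On the other rows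
    only the coordinates where [y] vanishes contribute to [A *m x]; if [x] is
    close to [y] these are small, so that [A *m x] stays below [a] there. *)
Lemma claim_preimage_away {d r : nat} (m i : nat) (A : 'M[R]_(r, d))
    (a : 'cV[R]_r) :
  (forall l j, 0 <= A l j) -> (forall l, 0 < a l 0) ->
  (1 <= i <= d)%N -> (i <= i_min m A)%N ->
  bounded_away (claim_preimage A a m) (CAcone i).
Proof.
move=> A0 a0 id ile.
have S0 l : 0 <= \sum_j A l j / a l 0.
  by apply: sumr_ge0 => j _; rewrite divr_ge0// ltW.
(* K bounds strictly each row sum of A relative to the barrier of that row. *)
pose K := 1 + \sum_l \sum_j A l j / a l 0.
have K0 : 0 < K by rewrite ltr_pwDl// sumr_ge0.
have rowK l : \sum_j A l j < K * a l 0.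
  rewrite -ltr_pdivrMr// mulr_suml ltr_pwDl// (bigD1 l)//= lerDl.
  exact: sumr_ge0.
exists K^-1; first by rewrite invr_gt0.
move=> x y [x0 [_ hx]] hy.
rewrite leNgt; apply/negP => xy.
have /card_Gamma_lt := leq_trans (card_pos_CAcone id hy) ile.
rewrite ltnNge => /negP; apply; apply: (leq_trans hx).
apply: subset_leq_card; apply/fintype.subsetP => l; rewrite !inE => al.
apply: contraTT al; rewrite negb_exists -leNgt => /forallP noj.
rewrite mxE; apply: le_trans (_ : \sum_j A l j * K^-1 <= _); last first.
  by rewrite -mulr_suml ler_pdivrMr// mulrC ltW.
apply: ler_sum => j _.
have := noj j; rewrite !inE negb_and -!leNgt => /orP[yj|Aj]; last first.
  have -> : A l j = 0 by apply/eqP; rewrite eq_le Aj A0.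
  by rewrite !mul0r.
apply: ler_wpM2l => //.
have := le_lt_trans (ler_coord_norm (x - y) j) xy.
have -> : (x - y) j 0 = x j 0.
  have yj0 : y j 0 = 0 by apply/eqP; rewrite eq_le yj; case: hy => /(_ j) ->.
  rewrite !mxE yj0.
  by rewrite subr0.
by move=> /ltW; apply: le_trans; exact: ler_norm.
Qed.

Lemma bounded_away_sub_Econe {d : nat} (i : nat) (B : set 'cV[R]_d) :
  B `<=` orthant -> bounded_away B (CAcone i) -> B `<=` Econe i.
Proof.
move=> Bo [e e0 away] x Bx; split; first exact: Bo.
rewrite /= lt_neqAle order_stat_ge0 ?andbT; last exact: Bo.
apply/negP => /eqP/esym xi.
have := away x x Bx (conj (Bo _ Bx) xi).
by rewrite subrr normr0 leNgt e0.
Qed.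

End Cones.

(** * Exceedance sets *)

Section Exceedance.
Context {R : realType} {r : nat}.
Implicit Types (th y : 'cV[R]_r) (m : nat).

(** The claim region and the ruin region both have this form. Keeping the
    threshold [th] variable lets them be compared by [exceed_mono]. *)
Definition exceed m th : set 'cV[R]_r :=
  [set y | (m <= #|[pred l : 'I_r | (th l 0 < y l 0)%R]|)%N].

Lemma exceed_mono m th th' y y' :
  (forall l, th l 0 < y l 0 -> th' l 0 < y' l 0) ->
  exceed m th y -> exceed m th' y'.
Proof.
move=> h; rewrite /exceed /= => /leq_trans; apply.
by apply: subset_leq_card; apply/fintype.subsetP => l; rewrite !inE; exact: h.
Qed.

(** The strict inequalities holding at the limit persist, and there are finitely
    many of them; others may only add to the count. *)
Lemma exceed_near {T : Type} {F : set_system T} {FF : Filter F} m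
    (th y : T -> 'cV[R]_r) th0 y0 :
  (forall l, th x l 0 @[x --> F] --> th0 l 0) ->
  (forall l, y x l 0 @[x --> F] --> y0 l 0) ->
  exceed m th0 y0 -> \forall x \near F, exceed m (th x) (y x).
Proof.
move=> cth cy h0.
have : \forall x \near F, forall l, th0 l 0 < y0 l 0 -> th x l 0 < y x l 0.
  apply: filter_forall => l.
  have [lt|_] := boolP (th0 l 0 < y0 l 0); last by near=> x.
  have pos : 0 < y0 l 0 - th0 l 0 by rewrite subr_gt0.
  near=> x => _; rewrite -subr_gt0; near: x.
  exact: (cvgr_gt _ (cvgB (cy l) (cth l)) _ pos).
by apply: filterS => x hx; exact: exceed_mono hx h0.
Unshelve. all: by end_near. Qed.

Lemma Lambda_reserveE {d : nat} {Omega : Type} (A : 'M[R]_(r, d))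
    (a p : 'cV[R]_r) (L : R -> Omega -> 'cV[R]_d) m u t w :
  Lambda m (reserve A a p L u t w) <-> exceed m (u *: a + t *: p) (A *m L t w).
Proof.
have lt0E l : ((u *: a + t *: p - A *m L t w) l 0 < 0) =
    ((u *: a + t *: p) l 0 < (A *m L t w) l 0).
  by rewrite mxE [X in _ + X]mxE subr_lt0.
by split; rewrite /Lambda /exceed /reserve /= => /leq_trans; apply;
  apply: subset_leq_card; apply/fintype.subsetP => l; rewrite !inE lt0E.
Qed.

End Exceedance.

Section LinearImage.
Context {R : realType} {d r : nat}.
Variable A : 'M[R]_(r, d).

Lemma cvg_mulmx_coord {T : Type} {F : set_system T} {FF : Filter F}
    (x : T -> 'cV[R]_d) x0 l :
  x t @[t --> F] --> x0 -> (A *m x t) l 0 @[t --> F] --> (A *m x0) l 0.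
Proof.
move=> cx; rewrite mxE; under eq_cvg do rewrite mxE.
apply: cvg_big => [|j _]; first exact: add_continuous.
apply: cvgMr.
exact: (cvg_comp _ _ cx (@coord_continuous _ _ _ j 0 x0)).
Qed.

Lemma mulmx_mono (x y : 'cV[R]_d) l : (forall l j, 0 <= A l j) ->
  orthant (y - x) -> (A *m x) l 0 <= (A *m y) l 0.
Proof.
move=> A0 xy; rewrite !mxE; apply: ler_sum => j _; apply: ler_wpM2l => //.
by have := xy j; rewrite !mxE subr_ge0.
Qed.

Lemma open_exceed_mulmx m (th : 'cV[R]_r) :
  open [set x : 'cV[R]_d | exceed m th (A *m x)].
Proof.
rewrite openE => x hx; rewrite /interior /=.
apply: (@exceed_near _ _ _ (nbhs x) _ m (fun=> th) (mulmx A) _ _ _ _ hx) => l.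
  exact: cvg_cst.
exact: cvg_mulmx_coord.
Qed.

End LinearImage.

(** * Borel sets of column vectors *)

Section Borel.
Context {R : realType} {d : nat}.

Lemma open_borelcV (U : set 'cV[R]_d) :
  open U -> measurable (U : set (borelcV R d)).
Proof. exact: sub_sigma_algebra. Qed.

Lemma closed_borelcV (U : set 'cV[R]_d) :
  closed U -> measurable (U : set (borelcV R d)).
Proof.
move=> cU; rewrite -[U]setCK; apply: measurableC.
by apply: open_borelcV; exact: closed_openC.
Qed.

Lemma closed_orthant : closed (@orthant R d).
Proof.
rewrite (_ : orthant = \bigcap_(j in setT)
    ((fun z : 'cV[R]_d => z j 0) @^-1` [set x | 0 <= x])).
  apply: closed_bigI => j _; apply: preimage_closed; last exact: closed_ge.
  by move=> z _; exact: coord_continuous.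
by apply/seteqP; split => z hz j; [move=> _|]; exact: hz.
Qed.

Lemma measurable_coord (j : 'I_d) :
  measurable_fun setT (fun z : borelcV R d => (z : 'cV[R]_d) j 0).
Proof.
apply: (measurability _ (measurable_realfun.RGenOpens.measurableE R)).
move=> _ [_ [x [y ->] <-]].
rewrite setTI; apply: open_borelcV; apply: open_comp; last exact: itv_open.
by move=> z _; exact: coord_continuous.
Qed.

End Borel.

Lemma negligible_bigcup_countType d (T : measurableType d) (R : realFieldType)
    (mu : {measure set T -> \bar R}) (I : countType) (F : I -> set T) :
  (forall i, mu.-negligible (F i)) -> mu.-negligible (\bigcup_i F i).
Proof.
move=> F0; apply: (@negligibleS _ _ _ _ (\bigcup_n oapp F set0 (unpickle n))).
  by move=> x [i _ Fix]; exists (pickle i) => //; rewrite pickleK.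
apply: negligible_bigcup => n.
by case: unpickle => [i|]; [exact: F0|exact: negligible_set0].
Qed.

(** * Ruin compared with the claims at the horizon *)

Section Ruin.
Context {R : realType} {disp : measure_display} {Omega : measurableType disp}.
Context {d r : nat}.
Variables (P : probability Omega R) (m : nat) (T : R) (A : 'M[R]_(r, d)).
Variables (L : R -> Omega -> 'cV[R]_d) (a p : 'cV[R]_r).
Hypotheses (T0 : 0 < T) (A0 : forall l j, 0 <= A l j).
Hypotheses (levyL : Levy P L).
Hypotheses (L0 : forall (t : R) w, 0 <= t -> orthant (L t w)).
Hypotheses (a0 : forall l, 0 < a l 0) (p0 : forall l, 0 <= p l 0).

Definition ruin_at (u t : R) : set Omega :=
  [set w | exceed m (u *: a + t *: p) (A *m L t w)].

Definition ruin (u : R) : set Omega :=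
  [set w | exists t : R, 0 <= t <= T /\ Lambda m (reserve A a p L u t w)].

Definition claim_event (s : R) : set Omega :=
  [set w | exceed m (s *: a) (A *m L T w)].

Lemma measurable_exceed (t : R) (th : 'cV[R]_r) : 0 <= t ->
  measurable [set w | exceed m th (A *m L t w)].
Proof.
move=> t0; rewrite -[X in measurable X]setTI.
have mL := Levy_meas levyL t0 measurableT.
by have := mL _ (open_borelcV (@open_exceed_mulmx _ _ _ A m th)).
Qed.

(** If ruin occurs at [t < T], right-continuity keeps the reserve in the open
    region [Lambda m] on some interval to the right of [t], which contains a
    rational time. *)
Lemma ruinE u : ruin u = ruin_at u T `|`
  \bigcup_(q : rat) (if 0 <= (ratr q : R) <= T then ruin_at u (ratr q) else set0).
Proof.
apply/seteqP; split => w.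
  move=> [t [/andP[t0 tT] /Lambda_reserveE ht]].
  have [Tt|tltT] := leP T t.
    by left; have <- : t = T by apply/eqP; rewrite eq_le tT.
  right.
  have : \forall s \near t^'+, exceed m (u *: a + s *: p) (A *m L s w).
    apply: (exceed_near _ _ ht) => l.
      rewrite !mxE; under eq_cvg do rewrite !mxE.
      apply: cvgD; first exact: cvg_cst.
      apply: cvgMl; apply: cvg_within_filter; exact: cvg_id.
    apply: cvg_mulmx_coord; exact: (Levy_right_continuous levyL).
  rewrite near_withinE => -[e /= e0 he].
  have tte : t < Num.min (t + e) T by rewrite lt_min tltT ltrDl e0.
  have [q] := rat_in_itvoo tte.
  rewrite in_itv /= lt_min => /and3P[tq qte qT].
  exists q => //; rewrite (le_trans t0 (ltW tq)) (ltW qT) /=.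
  apply: he => //=; rewrite distrC ger0_norm; lra.
case=> [wT|[q _]].
  by exists T; rewrite lexx (ltW T0); split=> //; exact/Lambda_reserveE.
case: ifPn => // qT wq.
by exists (ratr q); split=> //; exact/Lambda_reserveE.
Qed.

Lemma measurable_ruin u : measurable (ruin u).
Proof.
rewrite ruinE; apply: measurableU; first exact/measurable_exceed/ltW.
apply: bigcupT_measurable_rat => q; case: ifPn => // /andP[q0 _].
exact: measurable_exceed.
Qed.

Lemma measurable_claim_event s : measurable (claim_event s).
Proof. exact/measurable_exceed/ltW. Qed.

Definition decrease (s t : R) : set Omega :=
  [set w | (~` orthant) (L t w - L s w)].

Lemma measurable_decrease s t : 0 <= s -> 0 <= t -> measurable (decrease s t).
Proof.
move=> s0 t0.
rewrite (_ : decrease s t = ~` \bigcap_(j in @setT 'I_d)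
    [set w | L s w j 0 <= L t w j 0]); last first.
  apply/seteqP; split => w /= h.
    by apply: contra_not h => hj j; rewrite !mxE subr_ge0; exact: hj.
  by apply: contra_not h => h j _ /=; have := h j; rewrite !mxE subr_ge0.
apply: measurableC; apply: fin_bigcap_measurable => // j _.
rewrite -[X in measurable X]setTI.
have mL x : 0 <= x -> measurable_fun setT (fun w => L x w j 0).
  move=> x0; exact: (measurableT_comp (measurable_coord j) (Levy_meas levyL x0)).
exact: measurable_fun_le measurableT (mL s s0) (mL t t0).
Qed.

(** By stationarity the increment has the law of [L (t - s)], which lies in the
    orthant. *)
Lemma decrease_null s t : 0 <= s -> s <= t -> P (decrease s t) = 0%E.
Proof.
move=> s0 st; have mO := measurableC (closed_borelcV (@closed_orthant R d)).
rewrite /decrease (Levy_stationary levyL s0 st mO).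
rewrite (_ : [set w | _] = set0) ?measure0//.
by apply/seteqP; split => // w /=; apply; apply: L0; rewrite subr_ge0.
Qed.

(** Outside the countable union of the null events [decrease q T], ruin at a
    rational time [q] forces the same exceedances by [L T], with the premiums
    dropped. *)
Lemma ruin_le_claim u : (P (ruin u) <= P (claim_event u))%E.
Proof.
pose N := \bigcup_(q : rat)
  (if 0 <= (ratr q : R) <= T then decrease (ratr q) T else set0).
have mN : measurable N.
  apply: bigcupT_measurable_rat => q.
  by case: ifPn => // /andP[q0 _]; apply: measurable_decrease => //; exact: ltW.
have N0 : P N = 0%E.
  apply/(negligibleP P mN)/negligible_bigcup_countType => q.
  case: ifPn => [/andP[q0 qT]|_]; last exact: negligible_set0.
  apply/negligibleP; last exact: decrease_null.
  by apply: measurable_decrease => //; exact: ltW.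
have mE := measurable_claim_event u.
rewrite -(measureU0 mE mN N0); apply: le_measure.
- by rewrite inE; exact: measurable_ruin.
- by rewrite inE; exact: measurableU.
have incl t w : 0 <= t -> orthant (L T w - L t w) -> ruin_at u t w ->
    claim_event u w.
  move=> t0 tT; apply: exceed_mono => l h.
  apply: le_lt_trans (lt_le_trans h (mulmx_mono _ A0 tT)).
  by rewrite !mxE lerDl mulr_ge0.
rewrite ruinE => w [wT|[q _]].
  left; apply: incl wT; first exact: ltW.
  by rewrite subrr => j; rewrite mxE.
case: ifPn => // qT wq.
have [h|h] := pselect (orthant (L T w - L (ratr q) w)).
  by left; apply: incl h wq; case/andP: qT.
by right; exists q => //; rewrite qT.
Qed.

(** As soon as [T *: p <= (u * (g - 1)) *: a], exceeding [(u * g) *: a] means ruin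
    at time [T]. *)
Lemma claim_le_ruin g : 1 < g ->
  \forall u \near +oo, (P (claim_event (u * g)) <= P (ruin u))%E.
Proof.
move=> g1; near=> u.
apply: le_measure; [by rewrite inE; exact: measurable_claim_event|
  by rewrite inE; exact: measurable_ruin|].
move=> w hw; rewrite ruinE; left; move: hw; apply: exceed_mono => l.
apply: le_lt_trans; rewrite !mxE.
have -> : u * g * a l 0 = u * a l 0 + u * ((g - 1) * a l 0) by ring.
rewrite lerD2l -ler_pdivrMr; last by rewrite mulr_gt0// subr_gt0.
move: l; near: u; apply: filter_forall => l.
by apply: nbhs_pinfty_ge; rewrite num_real.
Unshelve. all: by end_near. Qed.

Lemma claim_event_anti s s' : s <= s' ->
  (P (claim_event s') <= P (claim_event s))%E.
Proof.
move=> ss; apply: le_measure;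
  [by rewrite inE; exact: measurable_claim_event..|].
move=> w; apply: exceed_mono => l; apply: le_lt_trans.
by rewrite !mxE ler_wpM2r// ltW.
Qed.

Lemma claim_eventE s : 0 < s ->
  [set w | ([set s *: x | x in claim_preimage A a m]) (L T w)] = claim_event s.
Proof.
move=> s0.
apply/seteqP; split => w.
  move=> [x [x0 [_ hx]] sx]; rewrite /claim_event /= -sx -scalemxAr.
  by apply: exceed_mono hx => l h; rewrite mxE [X in _ < X]mxE ltr_pM2l.
move=> hw; exists (s^-1 *: L T w); last by rewrite scalerA divff ?scale1r// gt_eqF.
have x0 : orthant (s^-1 *: L T w).
  by move=> j; rewrite mxE mulr_ge0 ?invr_ge0 ?(ltW s0)//; apply: L0; exact: ltW.
split=> //; split.
  by move=> l; rewrite mxE sumr_ge0// => j _; rewrite mulr_ge0.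
move: hw; rewrite /claim_event -scalemxAr; apply: exceed_mono => l.
by rewrite mxE [X in _ -> _ < X]mxE ltr_pdivlMl.
Qed.

Lemma measurable_claim_preimage :
  measurable (claim_preimage A a m : set (borelcV R d)).
Proof.
rewrite (_ : claim_preimage A a m = orthant `&` [set x | exceed m a (A *m x)]).
  apply: measurableI (closed_borelcV (@closed_orthant R d)) _.
  exact: open_borelcV (@open_exceed_mulmx _ _ _ A m a).
apply/seteqP; split => x [x0 hx]; split=> //; first by case: hx.
by split=> // l; rewrite mxE sumr_ge0// => j _; rewrite mulr_ge0.
Qed.

End Ruin.

Theorem proposition5p2 (R : realType) (disp : measure_display)
    (Omega : measurableType disp) (P : probability Omega R)
    (d r m : nat) (hd : (2 <= d)%N) (hr : (1 <= r)%N) (hm : (1 <= m <= r)%N)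
    (T : R) (hT : 0 < T)
    (A : 'M[R]_(r, d)) (hA : forall l j, 0 <= A l j)
    (hA0 : forall l, row l A != 0)
    (L : R -> Omega -> 'cV[R]_d)
    (alpha : nat -> R) (b : nat -> R -> R) (f : nat -> R -> {posnum R})
    (mu : nat -> {measure set (borelcV R d) -> \bar R})
    (hL : insurance_claim_assumption P L alpha b f mu)
    (a p : 'cV[R]_r) (ha : forall l, 0 < a l 0) (ha1 : \sum_l a l 0 = 1)
    (hp : forall l, 0 <= p l 0)
    (i : nat) (hi : i = i_min m A)
    (hb : forall x y : R, 0 <= x -> x <= y -> b i x <= b i y)
    (hC : continuity_set i (mu i) (claim_preimage A a m))
    (hC_pos : (0 < mu i (claim_preimage A a m))%E)
    (hC_fin : (mu i (claim_preimage A a m) < +oo)%E) :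
  ((ginv (b i) u)%:E * ruin_prob P A a p L m T u)%E @[u --> +oo] -->
    ((f i T)%:num%:E * mu i (claim_preimage A a m))%E.
Proof.
have id : (1 <= i <= d)%N.
  by rewrite hi; apply: i_min_bounds; [case/andP: hm|exact: ltnW].
have levyL := ICA_Levy hL.
have L0 := ICA_ge0 hL.
have away : bounded_away (claim_preimage A a m) (CAcone i).
  by apply: claim_preimage_away => //; rewrite hi.
have subE : claim_preimage A a m `<=` Econe i.
  by apply: bounded_away_sub_Econe away => x [].
have alpha0 : 0 < (alpha i)^-1 by rewrite invr_gt0; exact: ICA_alpha hL _ id.
have bRV := ICA_b hL id.
have := MRV_cvg (ICA_MRV hL id hT) (measurable_claim_preimage m a hA) subE away.
rewrite /continuity_set /= /mscale /= hC mule0 => /(_ erefl).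
have muC : mu i (claim_preimage A a m) = (fine (mu i (claim_preimage A a m)))%:E.
  by rewrite fineK// ge0_fin_numE// ltW.
rewrite muC -EFinM; set c := (_ * fine _).
have c0 : 0 <= c by rewrite mulr_ge0// fine_ge0// ltW.
pose q s := fine (P (claim_event m T A L a s)).
pose psi u := fine (P (ruin m T A L a p u)).
have qE s : P (claim_event m T A L a s) = (q s)%:E.
  rewrite fineK// fin_num_measure//.
  by apply: measurable_claim_event; [|exact: levyL].
have psiE u : ruin_prob P A a p L m T u = (psi u)%:E.
  rewrite fineK// fin_num_measure//.
  by apply: measurable_ruin; [|exact: levyL].
(* Needed for the positivity of b i u for large u, which makes the dilated claim
   region an exceedance event. *)
have [g _ growth] := RV_growth alpha0 bRV (ltr1n R 2).
move=> /(cvg_trans (near_eq_cvg _)) mrv.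
have {}mrv : (u * q (b i u))%:E @[u --> +oo] --> c%:E.
  apply: mrv; apply: filterS growth => u [bu0 _].
  by rewrite claim_eventE// qE EFinM.
move/fine_cvgP : mrv => [_ /= mrv].
under eq_cvg do rewrite psiE -EFinM.
apply: cvg_EFin; first exact: nearW.
apply: (cvg_ginv_tail alpha0 bRV hb _ _ c0 mrv).
- by move=> x y xy; rewrite -lee_fin -!qE; exact: claim_event_anti.
- by move=> u; exact: fine_ge0.
- by apply: nearW => u; rewrite -lee_fin -qE -psiE; exact: ruin_le_claim.
- move=> h h1; apply: filterS (claim_le_ruin m A p hT levyL ha h1).
  by move=> u; rewrite -lee_fin -qE -psiE.
Qed.
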